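(* Let $B=(V,E)$ be a (two-sided) generalized Bratteli diagram of bounded size with corresponding sequence $(t_n,L_n)_{n\in\mathbb N_0}$. For $w\in V_0$ put $$Z_w^+=\Big\{x=(x_n)\in X_B: s(x_0)\ge w\text{ and } r(x_n)\ge w+\sum_{i=0}^n t_i\ \text{ for all } n\in\mathbb N_0\Big\},$$ $$Z_w^-=\Big\{x=(x_n)\in X_B: s(x_0)\le w\text{ and } r(x_n)\le w-\sum_{i=0}^n t_i\ \text{ for all } n\in\mathbb N_0\Big\}.$$ Then, for every $w\in V_0$, the sets $Z_w^+$ and $Z_w^-$ are closed and nowhere dense with respect to the topology generated by cylinder sets. In particular, the tail equivalence relation $\mathcal R$ is not minimal.
   Context: A generalized Bratteli diagram is a graded graph $B=(V,E)$ with $V=\bigsqcup_{i\ge0}V_i$, $E=\bigsqcup_{i\ge0}E_i$, where every level $V_i$ is countably infinite, $E_i$ is a countable set of edges from $V_i$ to $V_{i+1}$ with source and range maps $s,r$ satisfying $s(E_i)=V_i$, $r(E_i)=V_{i+1}$, and $|r^{-1}(v)|<\infty$ for every $v\in V\setminus V_0$. The path space $X_B$ is the set of infinite paths $x=(x_i)_{i\ge0}$, $x_i\in E_i$, $r(x_i)=s(x_{i+1})$, with the topology generated by the cylinder sets $[\overline e]=\{x: x_0=e_0,\dots,x_n=e_n\}$. For $w\in V_n$, $v\in V_m$, $n<m$, $E(w,v)$ is the set of finite paths from $w$ to $v$. Bounded size: every level $V_n$ is identified with $\mathbb Z$, and there are pairs of natural numbers (positive integers) $(t_n,L_n)_{n\in\mathbb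 N_0}$, $\mathbb N_0=\{0,1,2,\dots\}$, such that for all $n\in\mathbb N_0$ and $v\in V_{n+1}$: $s(r^{-1}(v))\subset\{v-t_n,\dots,v+t_n\}$ and $|r^{-1}(v)|=\sum_{w\in V_n}|E(w,v)|\le L_n$. Convention: for each $n$, $t_n$ and $L_n$ are chosen minimal possible, and $E(v-t_n,v)$ and $E(v+t_n,v)$ are nonempty for all $n\in\mathbb N_0$ and all $v\in V_{n+1}$. Paths $x,y\in X_B$ are tail equivalent, $(x,y)\in\mathcal R$, if there is $n$ with $x_i=y_i$ for all $i\ge n$. $\mathcal R$ is minimal if every $\mathcal R$-class is dense in $X_B$ (equivalently, there is no proper nonempty closed $\mathcal R$-invariant subset). *)

(* Defs.v *)
From HB Require Import structures.
From mathcomp Require Import all_boot all_order all_algebra.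
From mathcomp Require Import boolp classical_sets functions cardinality.
From mathcomp Require Import topology.

Set Implicit Arguments.
Unset Strict Implicit.
Unset Printing Implicit Defensive.

Import Order.TTheory GRing.Theory Num.Theory.

Local Open Scope classical_set_scope.
Local Open Scope card_scope.
Local Open Scope ring_scope.

Record bratteli_diagram (V : nat -> Type) := BratteliDiagram {
  edge : nat -> Type;
  src : forall n, edge n -> V n;
  rng : forall n, edge n -> V n.+1;
  levels_countably_infinite : forall n, [set: V n] #= [set: nat];
  edges_countable : forall n, countable [set: edge n];
  src_surj : forall n, range (@src n) = [set: V n];
  rng_surj : forall n, range (@rng n) = [set: V n.+1];
  rng_finite_fibers : forall n (v : V n.+1), finite_set (@rng n @^-1` [set v])
}.

Section PathSpace.
Context {V : nat -> Type} (B : bratteli_diagram V).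

Definition edges_between n (w : V n) (v : V n.+1) : set (edge B n) :=
  [set e | src e = w /\ rng e = v].

(* A finite path starting at level 0 with n + 1 edges e_0, ..., e_n. *)
Record finite_path (n : nat) := FinitePath {
  finite_path_edge :> forall i : 'I_n.+1, edge B i;
  finite_path_edgeP : forall i (lti : (i.+1 < n.+1)%N),
        rng (finite_path_edge (Ordinal (ltnW lti))) =
        src (finite_path_edge (Ordinal lti))
}.

Record path_space := InfinitePath {
  path_edge :> forall i, edge B i;
  path_edgeP : forall i, rng (path_edge i) = src (path_edge i.+1)
}.

Definition cylinder n (e : finite_path n) : set path_space :=
  [set x : path_space | forall i : 'I_n.+1, x i = e i].

HB.instance Definition _ := gen_eqMixin path_space.
HB.instance Definition _ := gen_choiceMixin path_space.
HB.instance Definition _ := isSubBaseTopological.Build path_space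
  [set C | exists n (e : finite_path n), C = cylinder e] id.

Definition tail_equiv (x y : path_space) : Prop :=
  exists n, forall i, (n <= i)%N -> x i = y i.

Definition tail_minimal : Prop :=
  forall x : path_space, dense [set y | tail_equiv x y].

End PathSpace.

Arguments edges_between {V} B n w v.

Definition nowhere_dense (T : topologicalType) (A : set T) : Prop :=
  interior (closure A) = set0.

Definition two_sided_diagram := bratteli_diagram (fun=> int).

Section BoundedSize.
Variable B : two_sided_diagram.

Definition width_bound (n t : nat) : Prop :=
  (0 < t)%N /\
  forall v : int, @src _ B n @` (@rng _ B n @^-1` [set v]) `<=`
                  [set w : int | v - t%:Z <= w <= v + t%:Z].

Definition indegree_bound (n L : nat) : Prop :=
  (0 < L)%N /\ forall v : int, @rng _ B n @^-1` [set v] #<= `I_L.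

Definition least_nat (P : nat -> Prop) (m : nat) : Prop :=
  P m /\ forall k, P k -> (m <= k)%N.

(* Includes the convention that t n and L n are minimal and that the extreme
   sources v - t n and v + t n are attained for every v. *)
Definition bounded_size (t L : nat -> nat) : Prop :=
  forall n,
    [/\ least_nat (width_bound n) (t n),
        least_nat (indegree_bound n) (L n) &
        forall v : int,
          edges_between B n (v - (t n)%:Z) v !=set0 /\
          edges_between B n (v + (t n)%:Z) v !=set0].

Definition Zplus (t : nat -> nat) (w : int) : set (path_space B) :=
  [set x | (w <= src (x 0%N)) /\
     forall n, w + \sum_(0 <= i < n.+1) (t i)%:Z <= rng (x n)].

Definition Zminus (t : nat -> nat) (w : int) : set (path_space B) :=
  [set x | (src (x 0%N) <= w) /\
     forall n, rng (x n) <= w - \sum_(0 <= i < n.+1) (t i)%:Z].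

End BoundedSize.

Arguments Zplus B t w : clear implicits.
Arguments Zminus B t w : clear implicits.

(* Main.v *)
Require Import Defs.
From mathcomp Require Import all_boot all_order all_algebra.
From mathcomp Require Import finmap zify.
From mathcomp Require Import boolp classical_sets filter topology.

(** Write v_n for the vertex that a path x visits at level n, so that v_n is
    the source of x_n, and T_n for t_0 + ... + t_{n-1}.  Then x lies in the set
    Zplus w exactly when v_n - w >= T_n for every n, and in Zminus w exactly
    when -(v_n - w) >= T_n for every n.  Both are the case s = 1 or s = -1 of
    one set, the cone of the paths with s (v_n - w) >= T_n for all n, and
    everything is proved for a sign s.

    One edge between levels n and n+1 moves the vertex by at most t_n, and the
    convention on extremal edges makes both moves t_n and -t_n possible from
    every vertex.  Three facts follow.

    - The cone is closed, since each of its constraints reads a single edge of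
      the path ([closed_cone]).

    - The cone contains no cylinder: whatever the first N edges are, the path
      can go on forever with moves -s t_n.  From then on s (v_n - w) - T_n
      drops by 2 t_n >= 2 at each level, so that the constraint is violated
      eventually.  A closed set without interior is nowhere dense
      ([nowhere_dense_cone]).

    - The cone is invariant under tail equivalence: if the constraint holds at
      level n+1 then it holds at level n, because the last move was at most
      t_n; hence membership can be tested on any tail ([cone_tail_equiv]).

    The path that starts at w and always moves by s t_n belongs to the cone.
    Its tail class is contained in a closed set with empty interior, so it is
    not dense. *)

Set Implicit Arguments.
Unset Strict Implicit.
Unset Printing Implicit Defensive.

Import Order.TTheory GRing.Theory Num.Theory.

Local Open Scope classical_set_scope.
Local Open Scope ring_scope.

(** * Neighbourhoods in the path space *)

Section PrefixNeighbourhoods.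
Context {V : nat -> Type} (B : bratteli_diagram V).
Implicit Types x y : path_space B.

Definition agree_below (N : nat) x : set (path_space B) :=
  [set y | forall i, (i < N)%N -> y i = x i].

Definition prefix x n : finite_path B n :=
  @FinitePath _ B n (fun i => x i) (fun i lti => path_edgeP x i).

Lemma cylinder_open n (e : finite_path B n) : open (cylinder e).
Proof.
exists [set cylinder e]; last by rewrite bigcup_set1.
by move=> _ ->; apply: (@finI_from1 _ _ _ id); exists n, e.
Qed.

(** The cylinders form only a subbase, but the cylinders around a given path
    are nested, so that a finite intersection of them contains one of them. *)
Lemma nbhs_pathP x (U : set (path_space B)) :
  nbhs x U <-> exists N, agree_below N x `<=` U.
Proof.
split=> [|[N NU]]; last first.
  apply: (@filterS _ _ _ (cylinder (prefix x N))).
    by move=> y xy; apply: NU => i iN; exact: xy (@Ordinal N.+1 i (ltnW iN)).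
  by apply: open_nbhs_nbhs; split; [exact: cylinder_open | move].
rewrite nbhsE => -[O [[C finC <-] [A CA Ax]] OU].
have [D Dcyl defA] := finC _ CA.
suff [N NA] : exists N, agree_below N x `<=` A.
  by exists N => y /NA Ay; apply: OU; exists A.
have DN (c : set (path_space B)) : exists N, c \in D -> agree_below N x `<=` c.
  have [cD|cND] := pselect (c \in D); last by exists 0%N.
  have [n [e ce]] : exists n (e : finite_path B n), c = cylinder e.
    by have := Dcyl _ cD; rewrite inE.
  have xe : cylinder e x by rewrite -ce; move: Ax; rewrite -defA; exact.
  by exists n.+1 => _ y yx; rewrite ce => i; rewrite yx //; exact: xe.
have [N DNP] := choice DN.
exists (\max_(c <- D) N c)%N => y yx; rewrite -defA => c cD.
apply: (DNP c cD) => i iN; apply: yx; apply: leq_trans iN _.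
exact: leq_bigmax_seq.
Qed.

(** Edges chosen level by level form a path as soon as the vertices p n that
    they join are fixed in advance.  Parallel edges are possible, so the vertices
    do not determine the edges; P serves to prescribe an initial segment. *)
Lemma choose_path (p : forall n, V n) (P : forall n, edge B n -> Prop) :
  (forall n, exists e : edge B n, [/\ src e = p n, rng e = p n.+1 & P n e]) ->
  exists x, forall n, src (x n) = p n /\ P n (x n).
Proof.
move=> /(_ _)/cid-/all_tag[f fP].
have fpath n : rng (f n) = src (f n.+1).
  by have [_ -> _] := fP n; have [-> _ _] := fP n.+1.
by exists (InfinitePath fpath) => n; have [] := fP n.
Qed.

End PrefixNeighbourhoods.

(** * Cones of paths that move as fast as possible *)

Section Cones.
Variables (B : two_sided_diagram) (t L : nat -> nat).
Hypothesis hB : bounded_size B t L.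
Implicit Types (x y : path_space B) (w : int).

Definition vertex x n : int := src (x n).

Lemma vertexS x n : vertex x n.+1 = rng (x n).
Proof. by rewrite /vertex -path_edgeP. Qed.

Definition reach (m n : nat) : int := \sum_(m <= i < n) (t i)%:Z.

Lemma reachS m n : (m <= n)%N -> reach m n.+1 = reach m n + (t n)%:Z.
Proof. by move=> mn; rewrite /reach big_nat_recr. Qed.

Lemma reach_geq m n : (n <= m)%N -> reach m n = 0.
Proof. by move=> nm; rewrite /reach big_geq. Qed.

Lemma reach_cat m n p : (m <= n <= p)%N -> reach m p = reach m n + reach n p.
Proof. by move=> /andP[mn np]; rewrite /reach (big_cat_nat mn np). Qed.

Lemma width_gt0 n : (0 < t n)%N.
Proof. by have [[[]]] := hB n. Qed.

Lemma leq_reach m k : k%:Z <= reach m (m + k).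
Proof.
elim: k => [|k IHk]; first by rewrite addn0 reach_geq.
by rewrite addnS reachS ?leq_addr //; have := width_gt0 (m + k); lia.
Qed.

Lemma vertex_move x n :
  vertex x n.+1 - (t n)%:Z <= vertex x n <= vertex x n.+1 + (t n)%:Z.
Proof.
have [[[_ bnd] _] _ _] := hB n.
by rewrite vertexS; apply: (bnd (rng (x n))); exists (x n).
Qed.

(** One family for both signs, with the level 0 condition as the case n = 0:
    Zplus is the cone of sign 1 and Zminus the cone of sign -1. *)
Definition cone (s w : int) : set (path_space B) :=
  [set x | forall n, reach 0 n <= s * (vertex x n - w)].

Lemma ZplusE w : Zplus B t w = cone 1 w.
Proof.
apply/seteqP; split=> x /=.
  move=> [x0 xS] [|n]; first by rewrite reach_geq // mul1r subr_ge0.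
  by rewrite mul1r vertexS lerBrDl; exact: xS.
move=> xc; split=> [|n].
  by have := xc 0%N; rewrite reach_geq // mul1r subr_ge0.
by have := xc n.+1; rewrite mul1r vertexS lerBrDl.
Qed.

Lemma ZminusE w : Zminus B t w = cone (-1) w.
Proof.
apply/seteqP; split=> x /=.
  move=> [x0 xS] [|n]; first by rewrite reach_geq // mulN1r opprB subr_ge0.
  by rewrite mulN1r opprB vertexS lerBrDr addrC -lerBrDr; exact: xS.
move=> xc; split=> [|n].
  by have := xc 0%N; rewrite reach_geq // mulN1r opprB subr_ge0.
by have := xc n.+1; rewrite mulN1r opprB vertexS lerBrDl -lerBrDr.
Qed.

Lemma closed_cone (s w : int) : closed (cone s w).
Proof.
move=> x clx n.
have /clx[y [yc yx]] : nbhs x (agree_below n.+1 x).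
  by apply/nbhs_pathP; exists n.+1.
by rewrite /vertex -(yx n) //; exact: yc.
Qed.

Section Sign.
Variable s : int.
Hypothesis s_sign : s = 1 \/ s = -1.

(** The convention concerns the edges that enter a vertex; applied to the vertex
    v + s t_n, it provides an edge that leaves v. *)
Lemma extremal_edge n (v : int) :
  exists e : edge B n, src e = v /\ rng e = v + s * (t n)%:Z.
Proof.
have [_ _ ext] := hB n; case: s_sign => ->.
  have [[e [es er]] _] := ext (v + (t n)%:Z).
  by exists e; rewrite es er mul1r addrK.
have [_ [e [es er]]] := ext (v - (t n)%:Z).
by exists e; rewrite es er mulN1r subrK.
Qed.

Lemma drifting_path w :
  exists x, forall n, vertex x n = w + s * reach 0 n.
Proof.
have [|x xP] := @choose_path _ B (fun n => w + s * reach 0 n) (fun _ _ => True).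
  move=> n; have [e [es er]] := extremal_edge n (w + s * reach 0 n).
  by exists e; split=> //; rewrite er reachS // mulrDr addrA.
by exists x => n; have [] := xP n.
Qed.

(** Writing the prescribed vertex as the vertex of x at min n N plus the drift
    covers the prefix and the tail by a single formula, as reach N n vanishes
    for n <= N. *)
Lemma drift_after x N : exists2 y, agree_below N x y &
  forall n, (N <= n)%N -> vertex y n = vertex x N + s * reach N n.
Proof.
pose p n := vertex x (minn n N) + s * reach N n.
have [|y yP] := @choose_path _ B p (fun n e => (n < N)%N -> e = x n).
  move=> n; rewrite /p; have [nN|Nn] := ltnP n N.
    exists (x n); split=> //.
      by rewrite reach_geq ?(ltnW nN) // mulr0 addr0.
    by rewrite (minn_idPl nN) reach_geq // mulr0 addr0 vertexS.
  have [e [es er]] := extremal_edge n (vertex x N + s * reach N n).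
  exists e; split=> //.
  by rewrite er (minn_idPr (leqW Nn)) reachS // mulrDr addrA.
exists y => [n nN|n Nn]; first by have [_ ->] := yP n.
by have [yn _] := yP n; rewrite /vertex yn /p (minn_idPr Nn).
Qed.

(** From level n+1 to level n the left side falls by exactly t_n, and the right
    side by at most t_n since an edge moves the vertex by at most t_n. *)
Lemma cone_pred x w n : reach 0 n.+1 <= s * (vertex x n.+1 - w) ->
  reach 0 n <= s * (vertex x n - w).
Proof.
have := vertex_move x n; rewrite reachS //.
by case: s_sign => ->; lia.
Qed.

Lemma cone_tailP x w N :
  (forall n, (N <= n)%N -> reach 0 n <= s * (vertex x n - w)) -> cone s w x.
Proof.
elim: N => [xN n|N IHN xN]; first exact: xN.
apply: IHN => n; rewrite leq_eqVlt => /predU1P[<-|]; last exact: xN.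
by apply: cone_pred; exact: xN.
Qed.

Lemma cone_tail_equiv x y w : cone s w x -> tail_equiv x y -> cone s w y.
Proof.
move=> xc [N xy]; apply: (@cone_tailP _ _ N) => n Nn.
by rewrite /vertex -xy //; exact: xc.
Qed.

End Sign.

Lemma nowhere_dense_cone (s w : int) :
  s = 1 \/ s = -1 -> nowhere_dense (cone s w).
Proof.
move=> s_sign; have Ns_sign : - s = 1 \/ - s = -1.
  by case: s_sign => ->; [right | left; rewrite opprK].
rewrite /nowhere_dense -(closure_id _).1; last exact: closed_cone.
apply/seteqP; split=> // x /nbhs_pathP[N Ncone].
have [y yx ydrift] := drift_after Ns_sign x N.
(* The slack s (vertex x N - w) - reach 0 N is less than k, and k levels of
   drift lower it by at least 2k. *)
pose k := (absz (s * (vertex x N - w))).+1.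
have := Ncone y yx (N + k)%N; rewrite ydrift ?leq_addr //.
rewrite (@reach_cat 0 N) ?leq_addr //.
have := leq_reach N k; have := leq_reach 0 N; rewrite add0n /k.
by case: s_sign => ->; lia.
Qed.

End Cones.

(** * Topological consequences *)

Theorem theorem5p4 (B : two_sided_diagram) (t L : nat -> nat)
    (hB : bounded_size B t L) :
  (forall w : int,
     (closed (Zplus B t w) /\ nowhere_dense (Zplus B t w)) /\
     (closed (Zminus B t w) /\ nowhere_dense (Zminus B t w))) /\
  ~ tail_minimal B.
Proof.
have pos : 1 = 1 :> int \/ 1 = -1 :> int by left.
have neg : -1 = 1 :> int \/ -1 = -1 :> int by right.
split=> [w|minB].
  rewrite ZplusE ZminusE; split; split.
  - exact: closed_cone.
  - exact: (nowhere_dense_cone hB).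
  - exact: closed_cone.
  - exact: (nowhere_dense_cone hB).
have [x xdrift] := drifting_path hB pos 0.
have xcone : cone t 1 0 x by move=> n; rewrite xdrift add0r subr0 !mul1r.
have clB : closure (cone t 1 0) = [set: path_space B].
  apply/seteqP; split=> // y _ U; rewrite nbhsE => -[O [Oopen Oy] OU].
  have [z [Oz xz]] := minB x O (ex_intro _ y Oy) Oopen.
  by exists z; split; [exact: (cone_tail_equiv hB pos xcone xz) | exact: OU].
have := nowhere_dense_cone hB 0 pos.
by rewrite /nowhere_dense clB interiorT => /seteqP[/(_ x I)].
Qed.
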